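(* Let $\mathcal A$ be a free hyperplane arrangement in $\mathbb K^\ell$ ($\ell\ge 2$) with exponents $\exp(\mathcal A)=(1,d_2,\dots,d_\ell)$, $1\le d_2\le\dots\le d_\ell$. Let $H\in\mathcal A$ and $\mathcal A':=\mathcal A\setminus\{H\}$ (with $\mathcal A$ and $\mathcal A'$ essential). Then $r(\mathcal A')=d_2-1$ if and only if $|\mathcal A|-|\mathcal A^H|=d_2$. Otherwise $r(\mathcal A')=d_2$.
   Context: $\mathbb K$ is a field of characteristic zero, $V=\mathbb K^\ell$, $S=\mathbb K[x_1,\dots,x_\ell]$ with the standard grading, and $\operatorname{Der} S=\bigoplus_{i=1}^\ell S\,\partial_{x_i}$, where $\sum a_i\partial_{x_i}$ is homogeneous of degree $e$ if all $a_i\in S_e$; $\theta_E=\sum x_i\partial_{x_i}$ is the Euler derivation (degree $1$). A hyperplane arrangement $\mathcal A$ in $V$ is a finite set of (distinct) linear hyperplanes of $V$; it is essential if $\bigcap_{H\in\mathcal A}H=\{0\}$. For each $H\in\mathcal A$ fix a linear form $\alpha_H$ with $\ker\alpha_H=H$, and let $Q(\mathcal A)=\prod_{H\in\mathcal A}\alpha_H$. The logarithmic derivation module is $D(\mathcal A)=\{\theta\in\operatorname{Der}S\mid\theta(\alpha_H)\in S\alpha_H\ \forall H\in\mathcal A\}$, and $D_0(\mathcal A)=\{\theta\in\operatorname{Der}S\mid \theta(Q(\mathcal A))=0\}$; one has $D(\mathcal A)=D_0(\mathcal A)\oplus S\theta_E$. Put $r(\mathcal A)=\min\{e\mid D_0(\mathcal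 A)_e\ne 0\}$. $\mathcal A$ is free with exponents $(1,d_2,\dots,d_\ell)$ if $D(\mathcal A)$ is a free $S$-module with a homogeneous basis $\theta_1=\theta_E,\theta_2,\dots,\theta_\ell$, $\deg\theta_i=d_i$. For $H\in\mathcal A$, $\mathcal A^H=\{H\cap L\mid L\in\mathcal A\setminus\{H\}\}$. *)

(* Defs.v *)
From HB Require Import structures.
From mathcomp Require Import all_boot all_order all_algebra.
From mathcomp Require Import finmap mpoly.

Set Implicit Arguments.
Unset Strict Implicit.
Unset Printing Implicit Defensive.

Import GRing.Theory.

Local Open Scope fset_scope.
Local Open Scope ring_scope.

Section Arrangements.

Variables (K : fieldType) (l : nat).

Local Notation V := 'rV[K]_l.
Local Notation S := {mpoly K[l]}.

(* Der S = \bigoplus_i S \partial_{x_i}: a derivation is the row of its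
   coefficients. *)
Local Notation Der := 'rV[S]_l.

Definition der_app (theta : Der) (f : S) : S :=
  \sum_(i < l) theta 0 i * f^`M(i).

Definition der_homog (e : nat) (theta : Der) : Prop :=
  forall i : 'I_l, theta 0 i \is e.-homog.

Definition euler : Der := \row_(i < l) 'X_i.

Definition hyperplane (H : {vspace V}) : Prop := (\dim H).+1 = l.

Definition arrangement (A : {fset {vspace V}}) : Prop :=
  forall H, H \in A -> hyperplane H.

Definition essential (A : {fset {vspace V}}) : Prop :=
  (\bigcap_(H <- A) H)%VS = 0%VS.

Definition restriction (A : {fset {vspace V}}) (H : {vspace V}) :
    {fset {vspace V}} :=
  [fset (H :&: L)%VS | L in A `\ H].

(* Linear forms on V are the elements of S homogeneous of degree 1. *)
Definition defining_form (H : {vspace V}) (a : S) : Prop :=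
  a \is 1.-homog /\ forall v : V, (v \in H) = (a.@[fun i => v 0 i] == 0).

Section LogDer.

(* alpha H is the chosen linear form with kernel H; only its values on the
   hyperplanes of the arrangement matter. *)
Variables (alpha : {vspace V} -> S) (A : {fset {vspace V}}).

Definition defining_forms : Prop :=
  forall H, H \in A -> defining_form H (alpha H).

Definition Q : S := \prod_(H <- A) alpha H.

Definition in_D (theta : Der) : Prop :=
  forall H, H \in A -> exists g : S, der_app theta (alpha H) = g * alpha H.

Definition in_D0 (theta : Der) : Prop := der_app theta Q = 0.

Definition D0_deg_nonzero (e : nat) : Prop :=
  exists theta : Der, [/\ in_D0 theta, der_homog e theta & theta != 0].

(* r(A) = e, the minimum being given by its graph. *)
Definition r_is (e : nat) : Prop :=
  D0_deg_nonzero e /\ forall e', D0_deg_nonzero e' -> (e <= e')%N.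

Definition is_D_basis (b : 'I_l -> Der) : Prop :=
  [/\ forall i, in_D (b i),
      forall theta, in_D theta ->
        exists c : 'I_l -> S, theta = \sum_(i < l) c i *: b i
    & forall c : 'I_l -> S,
        \sum_(i < l) c i *: b i = 0 -> forall i, c i = 0].

(* d lists all l exponents; the one with index 0 belongs to the Euler
   derivation. *)
Definition free_with_exponents (d : seq nat) : Prop :=
  size d = l /\
  exists b : 'I_l -> Der,
    [/\ is_D_basis b,
        forall i : 'I_l, nat_of_ord i = 0%N -> b i = euler
      & forall i : 'I_l, der_homog (nth 0%N d i) (b i)].

End LogDer.

End Arrangements.

(* Main.v *)
Require Import Defs.
From HB Require Import structures.
From mathcomp Require Import all_boot all_order all_algebra.
From mathcomp Require Import finmap mpoly.
From mathcomp Require Import ring zify.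

Set Implicit Arguments.
Unset Strict Implicit.
Unset Printing Implicit Defensive.

Import GRing.Theory.

Local Open Scope fset_scope.
Local Open Scope ring_scope.

(** Write A' for A without H, a for the form of H,
and c for |A'| - |A^H|.

In characteristic zero, D_0(A') is nonzero in degree e exactly when D(A') has
a homogeneous element of degree e that is not a multiple of the Euler
derivation ([D0_deg_nonzeroP]).  Such elements of D(A) have degree at least
d_2 by homogeneity of the basis ([basis_degree_le]).  Since
D(A) <= D(A') and a D(A') <= D(A), it follows that r(A') is d_2 or d_2 - 1,
and everything is about the existence of an element of D(A') \ D(A) of degree
d_2 - 1.  Two facts locate the elements of D(A') \ D(A).

- Each of them has degree at least c ([deletion_degree_ge]).  Choose for each
  X in A^H a representative L in A' with X = H :&: L.  If theta is in D(A'),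
  the restriction of theta(a) to H is divisible by the product of the
  restricted forms of all the L in A' that were not chosen: this product is
  Terao's polynomial, of degree c.  When theta is not in D(A), the restriction
  of theta(a) to H is nonzero, so its degree is at least c.

- Some element phi of D(A') \ D(A) has degree exactly c
  ([deletion_derivation]).  By Saito's criterion ([saito_det]) the
  coefficient matrix M of a basis b_1, ..., b_l of D(A) has determinant Q(A)
  up to a unit.  If a involves x_k, the cofactors m_i of column k give
  sum_i m_i b_i = det M d/dx_k, which vanishes on H.  On H each m_i is
  divisible by the product q of the chosen restricted forms, because m_i is
  the determinant of derivations of H tangent to every X in A^H.  Dividing by
  q leaves coefficients n_i for which sum_i n_i b_i still vanishes on H, and
  phi is the quotient of this derivation by a.  On H, q phi(a) is Q(A') up to
  a unit, so a does not divide phi(a).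

If r(A') = d_2 - 1, an element realising it lies outside D(A), so
c <= d_2 - 1, and phi gives c >= d_2 - 1.  Conversely, if c = d_2 - 1 then phi
realises the degree d_2 - 1.

Restriction to H is done inside S, by the substitution [restr] that eliminates
x_k; its kernel is the ideal generated by a, so linear forms are prime. *)

(** * Divisibility in an integral domain *)

Section Divisibility.

Variable R : idomainType.
Implicit Types a b f g : R.

Definition divides a f : Prop := exists g, f = g * a.

Lemma dividesxx a : divides a a.
Proof. by exists 1; rewrite mul1r. Qed.

Lemma divides0 a : divides a 0.
Proof. by exists 0; rewrite mul0r. Qed.

Lemma dividesMl a f g : divides a f -> divides a (g * f).
Proof. by case=> h ->; exists (g * h); rewrite mulrA. Qed.

Lemma dividesMr a f g : divides a f -> divides a (f * g).
Proof. by rewrite mulrC; exact: dividesMl. Qed.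

Lemma dividesD a f g : divides a f -> divides a g -> divides a (f + g).
Proof. by case=> x -> [y ->]; exists (x + y); rewrite mulrDl. Qed.

Lemma dividesN a f : divides a f -> divides a (- f).
Proof. by case=> x ->; exists (- x); rewrite mulNr. Qed.

Lemma dividesB a f g : divides a f -> divides a g -> divides a (f - g).
Proof. by move=> af ag; apply/dividesD/dividesN. Qed.

Lemma divides_sum a I (r : seq I) (P : pred I) F :
  (forall i, P i -> divides a (F i)) -> divides a (\sum_(i <- r | P i) F i).
Proof.
by move=> aF; elim/big_ind: _ => //; [exact: divides0 | exact: dividesD].
Qed.

Lemma divides_trans a b f : divides a b -> divides b f -> divides a f.
Proof. by case=> x -> [y ->]; exists (y * x); rewrite mulrA. Qed.

Lemma divides_prod_mem (I : eqType) (r : seq I) (F : I -> R) i :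
  i \in r -> divides (F i) (\prod_(j <- r) F j).
Proof.
by move=> /(big_rem i) ->; apply/dividesMr/dividesxx.
Qed.

Definition prime_elt a : Prop :=
  [/\ a != 0, ~ divides a 1
    & forall f g, divides a (f * g) -> divides a f \/ divides a g].

Lemma prime_prod a I (r : seq I) (P : pred I) (F : I -> R) : prime_elt a ->
  (forall i, P i -> ~ divides a (F i)) -> ~ divides a (\prod_(i <- r | P i) F i).
Proof.
case=> _ a1 aM aF; elim/big_rec: _ => // i f Pi af /aM[] //.
exact: aF.
Qed.

(** Coprimality without gcds: b is not a zero divisor modulo a. *)
Definition coprime_to a b : Prop := forall f, divides a (b * f) -> divides a f.

Lemma prime_coprime_to a b : prime_elt a -> ~ divides a b -> coprime_to a b.
Proof. by case=> _ _ aM ab f /aM[]. Qed.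

Lemma coprime_to_prodr a I (r : seq I) (P : pred I) (F : I -> R) :
  (forall i, P i -> coprime_to a (F i)) ->
  coprime_to a (\prod_(i <- r | P i) F i).
Proof.
move=> aF; elim/big_rec: _ => [f|i f Pi af g]; first by rewrite mul1r.
by rewrite -mulrA => /(aF _ Pi)/af.
Qed.

Lemma coprime_to_mull a b f : a != 0 ->
  coprime_to a f -> coprime_to b f -> coprime_to (a * b) f.
Proof.
move=> a0 af bf g [h e].
have /af[g' ge] : divides a (f * g) by rewrite e; apply/dividesMl/dividesMr/dividesxx.
have /bf[h' he] : divides b (f * g').
  exists h; apply: (mulIf a0); rewrite -mulrA -ge e; ring.
by exists h'; rewrite ge he; ring.
Qed.

Lemma coprime_to_prodl b I (r : seq I) (P : pred I) (F : I -> R) :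
  (forall i, P i -> F i != 0) ->
  (forall i, P i -> coprime_to (F i) b) ->
  coprime_to (\prod_(i <- r | P i) F i) b.
Proof.
move=> F0 Fb; elim/big_rec: _ => [f _|i f Pi fb]; first by exists f; rewrite mulr1.
by apply: coprime_to_mull => //; [exact: F0 | exact: Fb].
Qed.

(** In the induction, f = g * p where p is the product over the tail, and the
    head divides p * g; being coprime to p, it divides g. *)
Lemma divides_prod (I : eqType) (r : seq I) (F : I -> R) f :
  uniq r -> {in r &, forall i j, i != j -> coprime_to (F i) (F j)} ->
  {in r, forall i, divides (F i) f} -> divides (\prod_(i <- r) F i) f.
Proof.
elim: r f => [|i r IHr] f /=; first by rewrite big_nil => *; exists f; rewrite mulr1.
case/andP=> ir ur Fcop Ff; rewrite big_cons.
have [g fE] : divides (\prod_(j <- r) F j) f.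
  apply: IHr => // [j k jr kr|j jr]; last by apply: Ff; rewrite inE jr orbT.
  by apply: Fcop; rewrite inE ?jr ?kr orbT.
have Fi : coprime_to (F i) (\prod_(j <- r) F j).
  rewrite big_seq; apply: coprime_to_prodr => j jr.
  apply: Fcop; rewrite ?inE ?eqxx ?jr ?orbT //.
  by apply: contraNneq ir => ->.
have /Fi[h gE] : divides (F i) ((\prod_(j <- r) F j) * g).
  by rewrite mulrC -fE; apply: Ff; rewrite inE eqxx.
by exists h; rewrite fE gE; ring.
Qed.

End Divisibility.

(** * Homogeneous polynomials, linear forms and derivations *)

Section Homogeneous.

Variables (K : fieldType) (l : nat).
Local Notation S := {mpoly K[l]}.
Implicit Types p q : S.

(** Multiplication by a homogeneous polynomial shifts the grading.  This makes
    quotients homogeneous, as well as the coordinates of a homogeneous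
    derivation on a homogeneous basis. *)
Lemma pihomogMr d e p q : q \is d.-homog ->
  pihomog mdeg e (p * q) = if (d <= e)%N then pihomog mdeg (e - d) p * q else 0.
Proof.
move=> hq; rewrite {1}[p]mpolyE mulr_suml raddf_sum /=.
have mono m : pihomog mdeg e (p@_m *: 'X_[m] * q) =
    if mdeg m + d == e then p@_m *: 'X_[m] * q else 0.
  have hm : p@_m *: 'X_[m] * q \is (mdeg m + d).-homog.
    by apply: dhomogM => //; rewrite dhomogZ // dhomogX.
  case: eqP => [<-|/eqP ne]; first by rewrite pihomog_dE.
  by rewrite (pihomog_ne0 ne).
rewrite (eq_bigr _ (fun m _ => mono m)); case: leqP => [le_de|lt_ed].
  rewrite -big_mkcond pihomogE mulr_suml; apply: eq_bigl => m.
  by rewrite -{1}(subnK le_de) eqn_add2r.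
rewrite big1 // => m _; case: eqP => // e_m.
by move: lt_ed; rewrite -e_m ltnNge leq_addl.
Qed.

(** The inequality between the degrees is stated for nonzero p because 0 is
    homogeneous of every degree; it is what keeps the truncated difference of
    degrees meaningful. *)
Lemma dhomog_divr d e p q : q != 0 -> q \is e.-homog -> p * q \is d.-homog ->
  p \is (d - e).-homog /\ (p != 0 -> (e <= d)%N).
Proof.
move=> q0 hq /pihomog_dE; rewrite (pihomogMr _ _ hq).
case: leqP => [le_ed /(mulIf q0) <-|_ /esym/eqP]; first by split=> //; exact: pihomogP.
by rewrite mulf_eq0 (negPf q0) orbF => /eqP ->; rewrite dhomog0 eqxx.
Qed.

Lemma dhomog_bigprod I (r : seq I) (P : pred I) (F : I -> S) (d : I -> nat) :
  (forall i, P i -> F i \is (d i).-homog) ->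
  \prod_(i <- r | P i) F i \is (\sum_(i <- r | P i) d i)%N.-homog.
Proof.
move=> hF; elim/big_rec2: _ => [|i e p Pi hp]; first exact: dhomog1.
by apply: dhomogM => //; exact: hF.
Qed.

Lemma dhomog_det n (M : 'M[S]_n) (d : 'I_n -> nat) :
  (forall i j, M i j \is (d i).-homog) -> \det M \is (\sum_i d i)%N.-homog.
Proof.
move=> hM; rewrite /determinant; apply: rpred_sum => s _.
by rewrite rpredMsign; apply: dhomog_bigprod.
Qed.

End Homogeneous.

Section LinearForms.

Variables (K : fieldType) (l : nat).
Local Notation S := {mpoly K[l]}.
Implicit Types a b f : S.

Lemma linform_sum f : f \is 1.-homog -> f = \sum_i f@_U_(i) *: 'X_i.
Proof.
move=> hf; apply/mpolyP => m; rewrite raddf_sum /=.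
have [/mdeg1P[i /eqP ->]|m1] := boolP (mdeg m == 1%N).
  rewrite (bigD1 i) //= big1 => [|j ji]; rewrite mcoeffZ mcoeffX.
    by rewrite eqxx mulr1 addr0.
  by rewrite eq_mnm1 (negPf ji) mulr0.
rewrite (dhomog_nemf_coeff hf) // big1 // => j _.
rewrite mcoeffZ mcoeffX; case: eqP => [e|]; last by rewrite mulr0.
by move: m1; rewrite -e mdeg1 eqxx.
Qed.

Lemma linformX i : ('X_i : S) \is 1.-homog.
Proof. by rewrite dhomogX; apply/eqP; exact: mdeg1. Qed.

Lemma linform_neq0 f : f \is 1.-homog -> f != 0 -> exists k, f@_U_(k) != 0.
Proof.
move=> hf f0; apply/existsP; apply: contra_neqT f0.
move=> /existsPn f0; rewrite (linform_sum hf) big1 // => i _.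
by move: (f0 i); rewrite negbK => /eqP ->; rewrite scale0r.
Qed.

Lemma linform_eval f (v : 'I_l -> K) : f \is 1.-homog ->
  f.@[v] = \sum_i f@_U_(i) * v i.
Proof.
move=> hf; rewrite {1}(linform_sum hf) raddf_sum /=; apply: eq_bigr => i _.
by rewrite mevalZ mevalXU.
Qed.

Lemma linform_deriv f i : f \is 1.-homog -> f^`M(i) = (f@_U_(i))%:MP.
Proof.
move=> hf; apply/mpolyP => m; rewrite mcoeff_mderiv mcoeffC.
case: (eqVneq m 0%MM) => [->|m0]; first by rewrite add0m mnm0E mulr1n mulr1.
rewrite (dhomog_nemf_coeff hf) ?mul0rn ?mulr0 //.
by rewrite /= mdegD mdeg1 addn1 eqSS mdeg_eq0.
Qed.

Lemma der_app_linform (theta : 'rV[S]_l) f : f \is 1.-homog ->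
  der_app theta f = \sum_i f@_U_(i) *: theta 0 i.
Proof.
move=> hf; apply: eq_bigr => i _.
by rewrite linform_deriv // mulrC mul_mpolyC.
Qed.

Section Elimination.

Variables (k : 'I_l) (a : S).
Hypothesis ha : a \is 1.-homog.
Hypothesis ak : a@_U_(k) != 0.

(** Restriction to the hyperplane a = 0 as an endomorphism of S: x_k is replaced
    by the combination of the other variables that equals it on the
    hyperplane. *)
Definition restr (p : S) : S :=
  p \mPo [tuple 'X_i - ((i == k)%:R / a@_U_(k)) *: a | i < l].

HB.instance Definition _ := GRing.RMorphism.copy restr
  (comp_mpoly [tuple 'X_i - ((i == k)%:R / a@_U_(k)) *: a | i < l]).

Lemma restrZ c p : restr (c *: p) = c *: restr p.
Proof. exact: comp_mpolyZ. Qed.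

Lemma restrX i : restr 'X_i = 'X_i - ((i == k)%:R / a@_U_(k)) *: a.
Proof. by rewrite /restr comp_mpolyXU -tnth_nth tnth_mktuple. Qed.

(** The polynomials congruent modulo a to their image are closed under the ring
    operations, and contain the constants and the variables. *)
Lemma restr_mod p : divides a (p - restr p).
Proof.
pose good q := divides a (q - restr q).
have goodM q r : good q -> good r -> good (q * r).
  move=> gq gr; rewrite /good rmorphM.
  have -> : q * r - restr q * restr r = (q - restr q) * r + restr q * (r - restr r).
    by ring.
  by apply: dividesD; [exact: dividesMr | exact: dividesMl].
have good1 : good 1 by rewrite /good rmorph1 subrr; exact: divides0.
have goodX i : good 'X_i.
  rewrite /good restrX opprB addrC subrK -mul_mpolyC.
  exact/dividesMl/dividesxx.
have goodXm m : good 'X_[m].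
  rewrite mpolyXE_id; elim/big_rec: _ => // i q _; apply: (goodM).
  by elim: (m i) => [|e IH]; rewrite ?expr0 // exprS; apply: goodM.
elim/mpolyind: p => [|c m p _ _ gp]; first by rewrite rmorph0 subrr; exact: divides0.
rewrite /good rmorphD /= restrZ opprD addrACA -scalerBr; apply: dividesD => //.
by rewrite -mul_mpolyC; apply: dividesMl; exact: goodXm.
Qed.

Lemma restr_linform f : f \is 1.-homog ->
  restr f = f - (f@_U_(k) / a@_U_(k)) *: a.
Proof.
move=> hf; rewrite {1}(linform_sum hf) rmorph_sum /=.
rewrite (eq_bigr (fun i => f@_U_(i) *: 'X_i
   - (f@_U_(i) * (i == k)%:R / a@_U_(k)) *: a)); last first.
  by move=> i _; rewrite restrZ restrX scalerBr scalerA mulrA.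
rewrite sumrB -(linform_sum hf); congr (_ - _).
rewrite (bigD1 k) //= eqxx mulr1 big1 ?addr0 // => i /negPf ->.
by rewrite mulr0 mul0r scale0r.
Qed.

Lemma restr_self : restr a = 0.
Proof. by rewrite restr_linform // divff // scale1r subrr. Qed.

Lemma restr_eq0 p : divides a p <-> restr p = 0.
Proof.
split=> [[g ->]|p0]; first by rewrite rmorphM /= restr_self mulr0.
by rewrite -[p]subr0 -p0; exact: restr_mod.
Qed.

Lemma restr_homog d p : p \is d.-homog -> restr p \is d.-homog.
Proof.
move=> hp; rewrite /restr comp_mpolyEX big_seq; apply: rpred_sum => m mp.
rewrite rpredZ // comp_mpolyX -(dhomog_mf hp mp) /= mdegE.
apply: dhomog_bigprod => i _; rewrite -{2}[m i]mul1n; apply: dhomogMn.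
by rewrite tnth_mktuple rpredB ?rpredZ ?linformX.
Qed.

Lemma restr_coeff f : f \is 1.-homog -> (restr f)@_U_(k) = 0.
Proof.
by move=> hf; rewrite restr_linform // mcoeffB mcoeffZ divfK // subrr.
Qed.

End Elimination.

(** The ideal of a is the kernel of a ring morphism into the domain S. *)
Lemma linform_prime a : a \is 1.-homog -> a != 0 -> prime_elt a.
Proof.
move=> ha a0; have [k ak] := linform_neq0 ha a0; split=> // [|f g].
  by rewrite (restr_eq0 ha ak) rmorph1 => /eqP; rewrite oner_eq0.
rewrite !(restr_eq0 ha ak) rmorphM => /eqP.
by rewrite mulf_eq0 => /orP[/eqP|/eqP]; [left|right].
Qed.

Lemma linform_eq0 f : f \is 1.-homog -> (forall v, f.@[v] = 0) -> f = 0.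
Proof.
move=> hf f0; rewrite (linform_sum hf) big1 // => i _.
have := f0 (fun j => (j == i)%:R); rewrite linform_eval // (bigD1 i) //= eqxx.
rewrite mulr1 big1 ?addr0 => [->|j /negPf ->]; by rewrite ?scale0r ?mulr0.
Qed.

(** The point w is the projection of v on the kernel of a along the k-th
    coordinate axis: restricting a form amounts to evaluating it there. *)
Lemma restr_ker k a (v : 'I_l -> K) :
  a \is 1.-homog -> a@_U_(k) != 0 -> exists w : 'I_l -> K,
   a.@[w] = 0 /\ forall f, f \is 1.-homog -> (restr k a f).@[v] = f.@[w].
Proof.
move=> ha ak; exists (fun i => v i - (i == k)%:R / a@_U_(k) * a.@[v]).
have ev g : g \is 1.-homog -> g.@[fun i => v i - (i == k)%:R / a@_U_(k) * a.@[v]]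
   = (restr k a g).@[v].
  move=> hg; rewrite restr_linform // mevalB mevalZ linform_eval //.
  rewrite [g.@[v]]linform_eval // (eq_bigr (fun i => g@_U_(i) * v i
     - g@_U_(i) * (i == k)%:R / a@_U_(k) * a.@[v])); last by move=> i _; ring.
  rewrite sumrB; congr (_ - _).
  rewrite (bigD1 k) //= eqxx mulr1 big1 ?addr0 // => i /negPf ->.
  by rewrite mulr0 !mul0r.
by split=> [|g hg]; rewrite ev // restr_self // meval0.
Qed.

Lemma linform_scale a f : a \is 1.-homog -> a != 0 -> f \is 1.-homog ->
  (forall v, a.@[v] = 0 -> f.@[v] = 0) -> exists c, f = c *: a.
Proof.
move=> ha a0 hf af; have [k ak] := linform_neq0 ha a0.
exists (f@_U_(k) / a@_U_(k)); apply/eqP; rewrite -subr_eq0 -restr_linform //.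
apply/eqP/linform_eq0 => [|v]; first exact: restr_homog.
have [w [aw ->//]] := restr_ker v ha ak; exact: af.
Qed.

(** Restriction to the kernel of a turns the claim into the proportionality of
    two linear forms, which is [linform_scale]. *)
Lemma linform_pencil a b f : a \is 1.-homog -> a != 0 ->
  b \is 1.-homog -> ~ divides a b -> f \is 1.-homog ->
  (forall v, a.@[v] = 0 -> b.@[v] = 0 -> f.@[v] = 0) ->
  exists c d, f = c *: a + d *: b.
Proof.
move=> ha a0 hb ab hf abf; have [k ak] := linform_neq0 ha a0.
have b0 : restr k a b != 0 by apply/eqP => /(restr_eq0 ha ak).
have [v|d] := linform_scale (restr_homog k ha hb) b0 (restr_homog k ha hf).
  by have [w [aw ew]] := restr_ker v ha ak; rewrite !ew //; exact: abf.
rewrite !restr_linform // => e.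
exists (f@_U_(k) / a@_U_(k) - d * (b@_U_(k) / a@_U_(k))), d.
rewrite -[LHS](subrK (f@_U_(k) / a@_U_(k) *: a)) e.
by rewrite scalerBr scalerBl scalerA addrC addrCA addrC.
Qed.

End LinearForms.

Section Derivations.

Variables (K : fieldType) (l : nat).
Local Notation S := {mpoly K[l]}.
Implicit Types (theta : 'rV[S]_l) (f g : S).

Lemma der_appM theta f g :
  der_app theta (f * g) = der_app theta f * g + f * der_app theta g.
Proof.
rewrite /der_app mulr_suml mulr_sumr -big_split /=; apply: eq_bigr => i _.
by rewrite mderivM; ring.
Qed.

Lemma der_app1 theta : der_app theta 1 = 0.
Proof. by rewrite /der_app big1 // => i _; rewrite -mpolyC1 mderivC mulr0. Qed.

Lemma der_appB theta f g : der_app theta (f - g) = der_app theta f - der_app theta g.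
Proof. by rewrite /der_app -sumrB; apply: eq_bigr => i _; rewrite mderivB mulrBr. Qed.

Lemma der_appD theta f g : der_app theta (f + g) = der_app theta f + der_app theta g.
Proof.
by rewrite /der_app -big_split; apply: eq_bigr => i _; rewrite mderivD mulrDr.
Qed.

Lemma der_appZ theta (c : K) f : der_app theta (c *: f) = c *: der_app theta f.
Proof.
by rewrite /der_app scaler_sumr; apply: eq_bigr => i _; rewrite mderivZ scalerAr.
Qed.

Lemma der_app_scale g theta f : der_app (g *: theta) f = g * der_app theta f.
Proof. by rewrite /der_app mulr_sumr; apply: eq_bigr => i _; rewrite mxE mulrA. Qed.

Lemma der_app_sub theta eta f :
  der_app (theta - eta) f = der_app theta f - der_app eta f.
Proof. by rewrite /der_app -sumrB; apply: eq_bigr => i _; rewrite !mxE mulrBl. Qed.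

Lemma der_app_sum n (c : 'I_n -> S) (b : 'I_n -> 'rV[S]_l) f :
  der_app (\sum_i c i *: b i) f = \sum_i c i * der_app (b i) f.
Proof.
rewrite /der_app; under [RHS]eq_bigr do rewrite mulr_sumr.
rewrite exchange_big; apply: eq_bigr => j _.
rewrite summxE mulr_suml; apply: eq_bigr => i _.
by rewrite mxE mulrA.
Qed.

Lemma der_app_euler f : f \is 1.-homog -> der_app (euler K l) f = f.
Proof.
move=> hf; rewrite der_app_linform // [RHS]linform_sum //.
by apply: eq_bigr => i _; rewrite mxE.
Qed.

Lemma der_app_homog e theta f : der_homog e theta -> f \is 1.-homog ->
  der_app theta f \is e.-homog.
Proof.
move=> ht hf; rewrite der_app_linform //; apply: rpred_sum => i _.
by apply: rpredZ; exact: ht.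
Qed.

(** Logarithmic derivatives add up. *)
Lemma der_app_prod theta (I : eqType) (r : seq I) (F g : I -> S) :
  (forall i, i \in r -> der_app theta (F i) = g i * F i) ->
  der_app theta (\prod_(i <- r) F i) = (\sum_(i <- r) g i) * \prod_(i <- r) F i.
Proof.
elim: r => [|i r IHr] hF; first by rewrite !big_nil der_app1 mul0r.
rewrite !big_cons der_appM hF ?inE ?eqxx // IHr => [|j jr]; first by ring.
by apply: hF; rewrite inE jr orbT.
Qed.

End Derivations.

(** * Hyperplanes and their forms *)

(** Applied to the map sending L to H :&: L, this chooses in the deletion one
    hyperplane for each element of the restriction. *)
Lemma fset_transversal (T U : choiceType) (f : T -> U) (A : {fset T}) :
  exists R : {fset T},
    [/\ R `<=` A, #|` R| = #|` [fset f x | x in A]|,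
        {in R &, injective f}
      & forall x, x \in A -> exists2 y, y \in R & f y = f x].
Proof.
case: (fset_0Vmem A) => [->|[x0 _]].
  by exists fset0; split=> //; rewrite ?imfset0 ?cardfs0 // => x; rewrite inE.
pose g y := nth x0 [seq x <- A | f x == y] 0.
have gP x : x \in A -> g (f x) \in A /\ f (g (f x)) = f x.
  move=> xA; have : g (f x) \in [seq z <- A | f z == f x].
    by rewrite mem_nth // size_filter -has_count; apply/hasP; exists x.
  by rewrite mem_filter => /andP[/eqP].
exists [fset g y | y in [fset f x | x in A]]; split.
- by apply/fsubsetP => _ /imfsetP[_ /imfsetP[x xA ->] ->]; have [] := gP x xA.
- rewrite card_in_imfset // => _ _ /imfsetP[x xA ->] /imfsetP[y yA ->] e.
  by have [_ <-] := gP x xA; have [_ <-] := gP y yA; rewrite e.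
- move=> _ _ /imfsetP[_ /imfsetP[x xA ->] ->] /imfsetP[_ /imfsetP[y yA ->] ->].
  by have [_ ->] := gP x xA; have [_ ->] := gP y yA => ->.
- move=> x xA; exists (g (f x)); last by have [] := gP x xA.
  by apply/imfsetP; exists (f x) => //; apply/imfsetP; exists x.
Qed.

Section DefiningForms.

Variables (K : fieldType) (l : nat).
Local Notation V := 'rV[K]_l.
Local Notation S := {mpoly K[l]}.
Implicit Types (H L : {vspace V}) (a b : S).

Lemma defining_form_neq0 H a : hyperplane H -> defining_form H a -> a != 0.
Proof.
move=> hH [_ aH]; apply/eqP => a0; move: hH.
have -> : H = fullv.
  by apply/vspaceP => v; rewrite aH a0 meval0 eqxx memvf.
rewrite /hyperplane dimvf /dim /= mul1n => /eqP.
by rewrite eqn_leq ltnn.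
Qed.

(** Divisibility of the forms is an inclusion of hyperplanes, and these have the
    same dimension. *)
Lemma defining_form_inj H L a b :
  hyperplane H -> defining_form H a -> hyperplane L -> defining_form L b ->
  divides a b -> H = L.
Proof.
move=> hH [_ aH] hL [_ bL] [g bE]; apply/eqP.
rewrite eqEdim; apply/andP; split; last by rewrite -ltnS hH hL.
apply/subvP => v; rewrite aH bL bE mevalM => /eqP ->.
by rewrite mulr0.
Qed.

Lemma hyperplane_cap H L : hyperplane H -> hyperplane L -> H != L ->
  ((\dim (H :&: L)).+2 = l)%N.
Proof.
move=> hH hL HL.
have lt : (\dim H < \dim (H + L))%N.
  rewrite ltnNge; apply: contra HL => le.
  have /eqP HE : H == (H + L)%VS by rewrite eqEdim addvSl.
  by rewrite eq_sym eqEdim HE addvSr -HE -ltnS hH hL leqnn.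
have := dimv_sum_cap H L.
have := dimvS (subvf (H + L)%VS); rewrite dimvf /dim /= mul1n.
move: lt hH hL; rewrite /hyperplane; lia.
Qed.

(** The zeros on H of the restricted forms are H :&: L and H :&: L', both of
    codimension two. *)
Lemma restr_defining_form_inj k H a L b L' b' :
  hyperplane H -> defining_form H a -> a@_U_(k) != 0 ->
  hyperplane L -> defining_form L b -> H != L ->
  hyperplane L' -> defining_form L' b' -> H != L' ->
  divides (restr k a b) (restr k a b') -> (H :&: L)%VS = (H :&: L')%VS.
Proof.
move=> hH [ha aH] ak hL [hb bL] HL hL' [hb' bL'] HL' [g e]; apply/eqP.
rewrite eqEdim -2!ltnS !hyperplane_cap // leqnn andbT.
apply/subvP => v; rewrite !memv_cap => /andP[vH]; rewrite vH bL bL'.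
move: vH; rewrite aH => /eqP av /eqP bv.
have := congr1 (meval (fun i => v 0 i)) e; rewrite mevalM !restr_linform //.
by rewrite !mevalB !mevalZ av bv !mulr0 !subr0 mulr0 => ->; rewrite eqxx.
Qed.

End DefiningForms.

(** * Logarithmic derivations of an arrangement and of its deletion *)

Lemma seq_choice (T : eqType) (U : Type) (u0 : U) (r : seq T)
    (P : T -> U -> Prop) :
  (forall x, x \in r -> exists u, P x u) ->
  exists g, forall x, x \in r -> P x (g x).
Proof.
elim: r => [|x r IHr] rP; first by exists (fun=> u0).
have [y yr|g gP] := IHr; first by apply: rP; rewrite inE yr orbT.
have [u xu] := rP x (mem_head x r).
exists (fun y => if y == x then u else g y) => y; rewrite inE.
by case: eqP => [->|_ /gP].
Qed.

Section Arrangement.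

Variables (K : fieldType) (l : nat).
Local Notation V := 'rV[K]_l.
Local Notation S := {mpoly K[l]}.
Variables (alpha : {vspace V} -> S) (A : {fset {vspace V}}).
Hypothesis hA : arrangement A.
Hypothesis halpha : defining_forms alpha A.
Implicit Types (H L : {vspace V}) (theta : 'rV[S]_l).

Lemma alpha_homog L : L \in A -> alpha L \is 1.-homog.
Proof. by move=> /halpha[]. Qed.

Lemma alpha_neq0 L : L \in A -> alpha L != 0.
Proof.
by move=> LA; apply: defining_form_neq0 (hA LA) (halpha LA).
Qed.

Lemma alpha_prime L : L \in A -> prime_elt (alpha L).
Proof. by move=> LA; apply: linform_prime; [exact: alpha_homog|exact: alpha_neq0]. Qed.

Lemma alpha_ndivides L L' : L \in A -> L' \in A -> L != L' ->
  ~ divides (alpha L) (alpha L').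
Proof.
move=> LA LA' /eqP LL' d; apply: LL'.
exact: defining_form_inj (hA LA) (halpha LA) (hA LA') (halpha LA') d.
Qed.

Lemma alpha_coprime L L' : L \in A -> L' \in A -> L != L' ->
  coprime_to (alpha L) (alpha L').
Proof.
move=> LA LA' LL'; by apply: prime_coprime_to; [exact: alpha_prime|exact: alpha_ndivides].
Qed.

Lemma Q_neq0 : Q alpha A != 0.
Proof.
rewrite /Q big_seq; elim/big_rec: _ => [|L p LA p0]; first exact: oner_neq0.
by rewrite mulf_neq0 // alpha_neq0.
Qed.

Lemma Q_homog : Q alpha A \is #|` A|.-homog.
Proof.
rewrite /Q big_seq cardfE -cardfE card_fset_sum1 [X in X.-homog]big_seq.
by apply: dhomog_bigprod => L; exact: alpha_homog.
Qed.

Lemma Q_fsetD1 H : H \in A -> Q alpha A = alpha H * Q alpha (A `\ H).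
Proof. by move=> HA; rewrite /Q (big_fsetD1 H). Qed.

(** By the Leibniz rule, theta(Q) is congruent modulo the form of L to
    theta(alpha L) times the product of the other forms, which is prime to
    alpha L. *)
Lemma D0_in_D theta : in_D0 alpha A theta -> in_D alpha A theta.
Proof.
rewrite /in_D0 => th0 L LA; move: th0; rewrite (Q_fsetD1 LA) der_appM => e.
have cop : coprime_to (alpha L) (Q alpha (A `\ L)).
  rewrite /Q big_seq; apply: coprime_to_prodr => L'; rewrite !inE => /andP[L'L L'A].
  by apply: alpha_coprime; rewrite // eq_sym.
apply: cop; exists (- der_app theta (Q alpha (A `\ L))).
by rewrite mulrC; apply/eqP; rewrite -subr_eq0 mulNr opprK [_ * alpha L]mulrC e.
Qed.

Lemma in_D_Q theta : in_D alpha A theta -> exists g,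
  [/\ forall L, L \in A -> der_app theta (alpha L) = g L * alpha L
    & der_app theta (Q alpha A) = (\sum_(L <- A) g L) * Q alpha A].
Proof.
by move=> /(seq_choice (0 : S))[g gP]; exists g; split=> //; apply: der_app_prod.
Qed.

Lemma euler_Q : der_app (euler K l) (Q alpha A) = #|` A|%:R * Q alpha A.
Proof.
rewrite /Q (@der_app_prod _ _ _ _ _ _ (fun=> 1)) => [|L LA].
  by rewrite big_const_seq count_predT iter_addr_0.
by rewrite mul1r der_app_euler // alpha_homog.
Qed.

Hypothesis hK : [pchar K] =i pred0.
Hypothesis A0 : A != fset0.

Lemma cardA_unit : #|` A|%:R != 0 :> K.
Proof. by have /pcharf0P -> := hK; rewrite cardfs_eq0. Qed.

Lemma in_D0_euler f : in_D0 alpha A (f *: euler K l) -> f = 0.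
Proof.
rewrite /in_D0 der_app_scale euler_Q => /eqP.
rewrite !mulf_eq0 (negPf Q_neq0) orbF => /orP[/eqP //|].
by rewrite -mpolyC_nat mpolyC_eq0 (negPf cardA_unit).
Qed.

(** This is the decomposition of D(A) as D_0(A) plus the multiples of the Euler
    derivation E: if theta(Q) = h Q, then |A| theta - h E annihilates Q, since
    E(Q) = |A| Q.  Characteristic zero makes |A| invertible. *)
Lemma D0_deg_nonzeroP e :
  D0_deg_nonzero alpha A e <->
  exists theta, [/\ in_D alpha A theta, der_homog e theta
                  & forall f, theta <> f *: euler K l].
Proof.
split=> [[theta [th0 hth th]]|[theta [thD hth thE]]].
  exists theta; split=> //; first exact: D0_in_D.
  move=> f thE; move: th0; rewrite thE => /in_D0_euler f0.
  by move: th; rewrite thE f0 scale0r eqxx.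
have [g [gP thQ]] := in_D_Q thD; set h := \sum_(L <- A) g L in thQ.
have hg L : L \in A -> g L \is (e - 1).-homog /\ (g L != 0 -> (0 < e)%N).
  move=> LA; apply: (dhomog_divr (alpha_neq0 LA) (alpha_homog LA)).
  by rewrite -gP //; apply: der_app_homog => //; exact: alpha_homog.
have hh : h \is (e - 1).-homog.
  by rewrite /h big_seq; apply: rpred_sum => L /hg[].
(* When e = 0 the truncated degree e - 1 says nothing, but then h = 0. *)
have h_e : h != 0 -> (0 < e)%N.
  rewrite lt0n; apply: contra_neq => e0; rewrite /h big_seq big1 // => L /hg[_].
  by rewrite e0; case: eqP => // _ /(_ isT).
exists ((#|` A|%:R)%:MP *: theta - h *: euler K l); split.
- by rewrite /in_D0 der_app_sub !der_app_scale thQ euler_Q mpolyC_nat; ring.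
- move=> i; rewrite !mxE; apply: rpredB; first by rewrite mul_mpolyC; exact/rpredZ/hth.
  have [->|/h_e e0] := eqVneq h 0; first by rewrite mul0r dhomog0.
  by rewrite -(subnK e0); apply: dhomogM => //; exact: linformX.
- apply/eqP => /eqP; rewrite subr_eq0 => /eqP thh.
  apply: (thE ((#|` A|%:R^-1)%:MP * h)); rewrite -scalerA -thh scalerA.
  by rewrite -mpolyCM mulVf ?cardA_unit // scale1r.
Qed.

End Arrangement.

Section Deletion.

Variables (K : fieldType) (l : nat).
Local Notation V := 'rV[K]_l.
Local Notation S := {mpoly K[l]}.
Variables (alpha : {vspace V} -> S) (A : {fset {vspace V}}).
Hypothesis hA : arrangement A.
Hypothesis halpha : defining_forms alpha A.
Variable H : {vspace V}.
Hypothesis HA : H \in A.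
Local Notation A' := (A `\ H).
Implicit Types (L : {vspace V}) (theta : 'rV[S]_l).

Lemma in_D_deletion theta : in_D alpha A theta -> in_D alpha A' theta.
Proof. by move=> thD L; rewrite !inE => /andP[_ /thD]. Qed.

Lemma in_D_deletion_mul theta : in_D alpha A' theta -> in_D alpha A (alpha H *: theta).
Proof.
move=> thD L LA; rewrite der_app_scale.
have [->|LH] := eqVneq L H; first by exists (der_app theta (alpha H)); rewrite mulrC.
have [|g ->] := thD L; first by rewrite !inE LH.
by exists (alpha H * g); rewrite mulrA.
Qed.

Lemma in_D_deletionP theta : in_D alpha A' theta ->
  in_D alpha A theta <-> divides (alpha H) (der_app theta (alpha H)).
Proof.
move=> thD; split=> [/(_ H HA)//|thH L LA].
by have [->//|LH] := eqVneq L H; apply: thD; rewrite !inE LH.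
Qed.

Variable k : 'I_l.
Hypothesis ak : (alpha H)@_U_(k) != 0.
Local Notation rho := (restr k (alpha H)).

Lemma rho_neq0 L : L \in A' -> rho (alpha L) != 0.
Proof.
rewrite !inE => /andP[LH LA]; apply/eqP.
move/(restr_eq0 (alpha_homog halpha HA) ak).
by apply: (alpha_ndivides hA halpha); rewrite // eq_sym.
Qed.

Lemma rho_homog L : L \in A' -> rho (alpha L) \is 1.-homog.
Proof.
rewrite !inE => /andP[_ LA].
by apply: restr_homog; apply: alpha_homog halpha _ _.
Qed.

Lemma rho_coprime L L' : L \in A' -> L' \in A' -> (H :&: L)%VS != (H :&: L')%VS ->
  coprime_to (rho (alpha L)) (rho (alpha L')).
Proof.
move=> LA LA' /eqP LL'; apply: prime_coprime_to.
  by apply: linform_prime; [exact: rho_homog | exact: rho_neq0].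
move: LA LA'; rewrite !inE => /andP[LH LA] /andP[LH' LA'] d; apply: LL'.
apply: restr_defining_form_inj d; rewrite // ?(eq_sym H); auto.
Qed.

Section TeraoPolynomial.

Variable R : {fset {vspace V}}.
Hypothesis RA : R `<=` A'.
Hypothesis Rsurj : forall L, L \in A' ->
  exists2 L0, L0 \in R & (H :&: L0)%VS = (H :&: L)%VS.

(** The hyperplanes containing X belong to a pencil: with L0 the representative
    of X, the form of L is s * alpha L0 + t * alpha H with t != 0.  If
    theta(alpha L0) = u * alpha L0, then theta(alpha L) is congruent to
    t * (theta(alpha H) - u * alpha H) modulo alpha L.  So the forms of all the
    other hyperplanes of the pencil divide the same polynomial, whose
    restriction to H is that of theta(alpha H). *)
Lemma class_divides theta X : in_D alpha A' theta ->
  divides (\prod_(L <- A' `\` R | (H :&: L)%VS == X) rho (alpha L))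
          (rho (der_app theta (alpha H))).
Proof.
move=> thD; set P := der_app theta (alpha H).
case: (fset_0Vmem [fset L in A' `\` R | (H :&: L)%VS == X]) => [E|[L1]].
  rewrite big_fset_condE E big_seq_fset0.
  by exists (rho P); rewrite mulr1.
rewrite !inE => /andP[/and3P[_ L1H L1A] /eqP L1X].
have [|L0 L0R L0X] := Rsurj (L := L1); first by rewrite !inE L1H.
have /(fsubsetP RA) L0A' := L0R; have := L0A'; rewrite !inE => /andP[L0H L0A].
have [u uE] := thD L0 L0A'.
have dvd L : L \in [seq L <- A' `\` R | (H :&: L)%VS == X] ->
    divides (alpha L) (P - u * alpha H).
  rewrite mem_filter !inE => /andP[/eqP LX /and3P[LR LH LA]].
  have LL0 : L0 != L by apply: contraNneq LR => <-.
  have HL0 : ~ divides (alpha L0) (alpha H) by apply: (alpha_ndivides hA halpha).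
  have [v L0v Hv|s [t E]] := linform_pencil (alpha_homog halpha L0A)
      (alpha_neq0 hA halpha L0A) (alpha_homog halpha HA) HL0 (alpha_homog halpha LA).
    have capE : (\row_i v i \in H :&: L0)%VS = (\row_i v i \in H :&: L)%VS.
      by rewrite L0X L1X LX.
    have ev f : f.@[fun i => (\row_i v i) 0 i] = f.@[v].
      by apply: meval_eq => i; rewrite mxE.
    move: capE; rewrite !memv_cap (halpha HA).2 (halpha L0A).2 (halpha LA).2 !ev.
    by rewrite L0v Hv eqxx => /esym/eqP.
  have t0 : t != 0.
    apply/eqP => t0; apply: (alpha_ndivides hA halpha L0A LA LL0).
    by rewrite E t0 scale0r addr0 -mul_mpolyC; exact/dividesMl/dividesxx.
  have [g gE] := thD L (ltac:(by rewrite !inE LH)).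
  exists (t^-1%:MP * (g - u)).
  have -> : P - u * alpha H = t^-1%:MP * (t%:MP * P - t%:MP * (u * alpha H)).
    by rewrite -mulrBr mulrA -mpolyCM mulVf // mul1r.
  rewrite -mulrA; congr (_ * _); rewrite mulrBl -gE {1}E der_appD !der_appZ uE.
  by rewrite {1}E -!mul_mpolyC -/P; ring.
have [w wE] : divides (\prod_(L <- [seq L <- A' `\` R | (H :&: L)%VS == X]) alpha L)
    (P - u * alpha H).
  apply: divides_prod => //; first exact/filter_uniq/fset_uniq.
  move=> L L'; rewrite !mem_filter !inE.
  move=> /andP[_ /and3P[_ _ LA]] /andP[_ /and3P[_ _ LA']].
  exact: (alpha_coprime hA halpha).
exists (rho w); move/(congr1 rho): wE; rewrite rmorphB !rmorphM /=.
rewrite (restr_self (alpha_homog halpha HA) ak) mulr0 subr0 rmorph_prod => ->.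
by rewrite big_filter.
Qed.

(** Restricted forms coming from different X are coprime, so the divisibilities
    obtained pencil by pencil multiply. *)
Lemma der_divides theta : in_D alpha A' theta ->
  divides (\prod_(L <- A' `\` R) rho (alpha L)) (rho (der_app theta (alpha H))).
Proof.
move=> thD; rewrite (partition_big_imfset _ (fun L => (H :&: L)%VS)) /=.
apply: divides_prod => [|X Y _ _ XY|X _]; first exact: fset_uniq.
  rewrite [X in coprime_to X _]big_seq_cond [X in coprime_to _ X]big_seq_cond.
  apply: coprime_to_prodl => L; rewrite in_fsetD => /andP[/andP[_ LA] /eqP LX].
    exact: rho_neq0.
  apply: coprime_to_prodr => L'; rewrite in_fsetD => /andP[/andP[_ LA']] /eqP LY.
  by apply: rho_coprime; rewrite // LX LY.
exact: class_divides.
Qed.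

(** A derivation of the deletion lies outside D(A) exactly when the restriction
    of theta(alpha H) to H is nonzero; a nonzero multiple of Terao's polynomial
    has at least its degree. *)
Lemma deletion_degree_ge e theta : in_D alpha A' theta -> der_homog e theta ->
  ~ in_D alpha A theta -> (#|` A'| - #|` R| <= e)%N.
Proof.
move=> thD hth thA; have [w wE] := der_divides thD.
have P0 : rho (der_app theta (alpha H)) != 0.
  by apply/eqP => /(restr_eq0 (alpha_homog halpha HA) ak)/(in_D_deletionP thD).
have TA L : L \in A' `\` R -> L \in A' by rewrite in_fsetD => /andP[].
have T0 : \prod_(L <- A' `\` R) rho (alpha L) != 0.
  rewrite big_seq; elim/big_rec: _ => [|L p /TA LA p0]; first exact: oner_neq0.
  by rewrite mulf_neq0 // rho_neq0.
have hT : \prod_(L <- A' `\` R) rho (alpha L) \is (#|` A'| - #|` R|)%N.-homog.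
  rewrite -cardfsDS // card_fset_sum1 big_seq [X in X.-homog]big_seq.
  by apply: dhomog_bigprod => L /TA; exact: rho_homog.
have hP : rho (der_app theta (alpha H)) \is e.-homog.
  by apply/restr_homog/der_app_homog => //; apply: alpha_homog halpha _ _.
have [|_] := dhomog_divr (p := w) T0 hT (d := e); first by rewrite -wE.
by apply; apply: contraNneq P0 => w0; rewrite wE w0 mul0r.
Qed.

End TeraoPolynomial.
End Deletion.

(** * Determinants and Saito's criterion *)

Lemma coprime_to_prime (R : idomainType) (a u : R) :
  prime_elt a -> ~ divides a u -> coprime_to u a.
Proof.
case=> a0 _ aM au f [w e].
have /aM[] // : divides a (w * u) by rewrite -e; exact/dividesMr/dividesxx.
by case=> w' wE; exists w'; apply: (mulfI a0); rewrite e wE; ring.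
Qed.

Section Determinants.

Variables (K : fieldType) (l : nat).
Local Notation S := {mpoly K[l]}.
Implicit Types a u f : S.

Lemma divides_scale a f (c : K) : c != 0 -> divides a (c *: f) -> divides a f.
Proof.
move=> c0 [g e]; exists (c^-1 *: g).
by rewrite -scalerAl -e scalerA mulVf // scale1r.
Qed.

(** Cramer's rule: the adjugate of N sends N c to det N times c. *)
Lemma det_divides n (N : 'M[S]_n) (c : 'I_n -> K) j0 a : c j0 != 0 ->
  (forall i, divides a (\sum_j c j *: N i j)) -> divides a (\det N).
Proof.
move=> c0 Nc; apply: (divides_scale c0).
have -> : c j0 *: \det N = \sum_i \adj N j0 i * \sum_j c j *: N i j.
  transitivity (\sum_j c j *: (\adj N *m N) j0 j).
    rewrite mul_adj_mx (bigD1 j0) //= mxE eqxx mulr1n.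
    rewrite [X in _ + X]big1 ?addr0 // => j jj0.
    by rewrite mxE eq_sym (negPf jj0) mulr0n scaler0.
  under [RHS]eq_bigr do rewrite mulr_sumr.
  rewrite exchange_big /=; apply: eq_bigr => j _.
  by rewrite mxE scaler_sumr; apply: eq_bigr => i _; rewrite scalerAr.
by apply: divides_sum => i _; exact: dividesMl.
Qed.

(** A vector with zero k-th entry is not affected by the deletion of column k,
    so this is [det_divides] for the minor. *)
Lemma cofactor_divides n (N : 'M[S]_n) (c : 'I_n -> K) i k j0 a :
  c k = 0 -> c j0 != 0 ->
  (forall i', i' != i -> divides a (\sum_j c j *: N i' j)) ->
  divides a (cofactor N i k).
Proof.
case: n N c i k j0 => [|n] N c i k j0; first by case: i.
move=> ck cj0 Nc; rewrite /cofactor; apply: dividesMl.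
have : j0 != k by apply: contra_neq cj0 => ->.
rewrite eq_sym => /unlift_some[j1 j0E _].
apply: (@det_divides _ _ (c \o lift k) j1) => [|i' /=]; first by rewrite /= -j0E.
have := Nc (lift i i'); rewrite eq_sym neq_lift => /(_ isT).
rewrite (bigD1_ord k) //= ck scale0r add0r => Ni'.
by under eq_bigr do rewrite !mxE.
Qed.

Lemma cofactor_homog n (N : 'M[S]_n) (d : 'I_n -> nat) i k :
  (forall i j, N i j \is (d i).-homog) ->
  cofactor N i k \is (\sum_(i' | i' != i) d i')%N.-homog.
Proof.
case: n N d i k => [|n] N d i k; first by case: i.
move=> hN; rewrite /cofactor rpredMsign.
have -> : (\sum_(i' | i' != i) d i' = \sum_(i' < n) d (lift i i'))%N.
  have dE : (\sum_i' d i' = d i + \sum_(i' | i' != i) d i')%N by rewrite (bigD1 i).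
  by apply: (@addnI (d i)); rewrite -dE (bigD1_ord i).
by apply: dhomog_det => i' j; rewrite !mxE.
Qed.

End Determinants.

Section Saito.

Variables (K : fieldType) (l : nat).
Local Notation V := 'rV[K]_l.
Local Notation S := {mpoly K[l]}.
Variables (alpha : {vspace V} -> S) (A : {fset {vspace V}}).
Hypothesis hA : arrangement A.
Hypothesis halpha : defining_forms alpha A.
Variable b : 'I_l -> 'rV[S]_l.
Hypothesis hb : is_D_basis alpha A b.
Implicit Types (L : {vspace V}) (theta : 'rV[S]_l).

Definition coef_mx : 'M[S]_l := \matrix_(i, j) b i 0 j.
Local Notation M := coef_mx.

(** The matrix M sends the coefficient vector of alpha L to the vector of the
    b_i(alpha L), which are multiples of alpha L. *)
Lemma Q_divides_det : divides (Q alpha A) (\det M).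
Proof.
apply: divides_prod => [|L L' LA LA' LL'|L LA]; first exact: fset_uniq.
  exact: (alpha_coprime hA halpha LA LA' LL').
have [j0 c0] := linform_neq0 (alpha_homog halpha LA) (alpha_neq0 hA halpha LA).
apply: (det_divides (c := fun j => (alpha L)@_U_(j)) c0) => i; have [bD _ _] := hb.
have [g gE] := bD i L LA; exists g.
rewrite -gE der_app_linform ?(alpha_homog halpha) //.
by apply: eq_bigr => j _; rewrite mxE.
Qed.

(** The derivations Q(A) d/dx_k and Q(A \ L) (a_k d/dx_j - a_j d/dx_k), for j
    different from k, belong to D(A), where the a_j are the coefficients of
    alpha L.  Their coefficient matrix N is thus a multiple of M.  In the
    coordinates where alpha L replaces x_k, a change expressed by P, it becomes
    diagonal. *)
Lemma det_divides_adapted L k : L \in A -> (alpha L)@_U_(k) != 0 ->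
  divides (\det M)
    (\prod_j ((alpha L)@_U_(k) *: (if j == k then Q alpha A else Q alpha (A `\ L)))).
Proof.
move=> LA ak; pose c j := (alpha L)@_U_(j)%MM; rewrite -/(c k) in ak *.
pose dl j : 'rV[S]_l := delta_mx 0 j.
pose eta j := if j == k then Q alpha A *: dl k
  else Q alpha (A `\ L) *: ((c k)%:MP *: dl j - (c j)%:MP *: dl k).
have der_dl j f : f \is 1.-homog -> der_app (dl j) f = (f@_U_(j))%:MP.
  move=> hf; rewrite der_app_linform // (bigD1 j) //= big1 => [|i ij].
    by rewrite mxE !eqxx addr0 -mul_mpolyC mulr1.
  by rewrite mxE (negPf ij) andbF scaler0.
have der_eta j f : f \is 1.-homog -> der_app (eta j) f =
    if j == k then f@_U_(k) *: Q alpha A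
    else (c k * f@_U_(j) - c j * f@_U_(k)) *: Q alpha (A `\ L).
  move=> hf; rewrite /eta; case: eqP => _; rewrite der_app_scale.
    by rewrite der_dl // mulrC mul_mpolyC.
  rewrite der_app_sub !der_app_scale !der_dl // mulrC -mul_mpolyC.
  by rewrite mpolyCB !mpolyCM.
have etaD j : in_D alpha A (eta j).
  move=> L' LA'; rewrite der_eta ?(alpha_homog halpha) //.
  rewrite -/(divides _ _); case: (eqVneq j k) => _.
    by rewrite -mul_mpolyC; apply/dividesMl/divides_prod_mem.
  have [->|LL'] := eqVneq L' L; first by rewrite mulrC subrr scale0r; exact: divides0.
  rewrite -mul_mpolyC; apply/dividesMl/divides_prod_mem.
  by rewrite !inE LL'.
have [_ bS _] := hb.
have [C CE] := fin_all_exists (fun j => bS (eta j) (etaD j)).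
pose N : 'M[S]_l := \matrix_(j, i) eta j 0 i.
pose P : 'M[S]_l := \matrix_(i, j) if j == k then (c i)%:MP else (i == j)%:R.
have NE : N = (\matrix_(j, i) C j i) *m M.
  apply/matrixP => j i; rewrite !mxE CE summxE; apply: eq_bigr => m _.
  by rewrite !mxE.
have NP : N *m P = diag_mx
    (\row_j (c k *: (if j == k then Q alpha A else Q alpha (A `\ L)))).
  apply/matrixP => j i; rewrite !mxE.
  have [->|ik] := eqVneq i k.
    transitivity (der_app (eta j) (alpha L)).
      rewrite der_app_linform ?(alpha_homog halpha) //; apply: eq_bigr => m _.
      by rewrite !mxE eqxx mulrC mul_mpolyC.
    rewrite der_eta ?(alpha_homog halpha) //.
    case: eqP => _; first by rewrite mulr1n.
    by rewrite mulr0n mulrC subrr scale0r.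
  transitivity (eta j 0 i).
    rewrite (bigD1 i) //= !mxE eqxx (negPf ik) mulr1 big1 ?addr0 // => m mi.
    by rewrite !mxE (negPf ik) (negPf mi) mulr0.
  rewrite /eta /dl; case: (eqVneq j k) => [->|jk]; rewrite !mxE /=.
    by rewrite [k == i]eq_sym (negPf ik) mulr0.
  rewrite (negPf ik) mulr0 subr0 [i == j]eq_sym.
  by case: eqP => _; rewrite ?mulr0 // mulr1 mulrC mul_mpolyC.
have := congr1 determinant NP; rewrite det_diag det_mulmx NE det_mulmx => e.
exists (\det (\matrix_(j, i) C j i) * \det P); rewrite mulrAC e.
by apply: eq_bigr => j _; rewrite mxE.
Qed.

Hypothesis A0 : A != fset0.

(** One half of Saito's criterion.  The quotient u of det M by Q divides, for
    each L, a nonzero scalar times a product of forms other than alpha L by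
    [det_divides_adapted].  Hence no form divides u, and a divisor of such a
    product that is prime to all its factors is a unit. *)
Lemma saito_det : exists u, [/\ \det M = u * Q alpha A & divides u 1].
Proof.
have [u uE] := Q_divides_det; exists u; split=> //.
have u_dvd L k : L \in A -> (alpha L)@_U_(k) != 0 ->
   divides u ((alpha L)@_U_(k) *:
     \prod_(j | j != k) ((alpha L)@_U_(k) *: Q alpha (A `\ L))).
  move=> LA ak; have [z] := det_divides_adapted LA ak.
  rewrite uE (bigD1 k) //= eqxx => e; exists z; apply: (mulfI (Q_neq0 hA halpha)).
  rewrite -scalerAr scalerAl.
  rewrite (eq_bigr (fun j => (alpha L)@_U_(k) *: Q alpha (A `\ L))) in e *.
    by rewrite e; ring.
  by move=> j /negPf ->.
have ndiv L : L \in A -> ~ divides (alpha L) u.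
  move=> LA au.
  have [k ak] := linform_neq0 (alpha_homog halpha LA) (alpha_neq0 hA halpha LA).
  have := divides_trans au (u_dvd L k LA ak) => /(divides_scale ak).
  apply: prime_prod (alpha_prime hA halpha LA) _ => j _ /(divides_scale ak).
  rewrite /Q big_seq; apply: prime_prod (alpha_prime hA halpha LA) _ => L'.
  by rewrite !inE => /andP[LL' LA']; apply: (alpha_ndivides hA halpha); rewrite // eq_sym.
have [L LA] : exists L, L \in A by have [e|[L]] := fset_0Vmem A; [case/eqP: A0|exists L].
have [k ak] := linform_neq0 (alpha_homog halpha LA) (alpha_neq0 hA halpha LA).
have /(divides_scale ak) := u_dvd L k LA ak; rewrite -[X in divides _ X]mulr1.
apply: coprime_to_prodr => j _ f; rewrite -scalerAl => /(divides_scale ak).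
rewrite /Q big_seq; apply: coprime_to_prodr => L'; rewrite !inE => /andP[_ LA'].
by apply: coprime_to_prime; [exact: alpha_prime LA'|exact: ndiv].
Qed.

Lemma sum_exponents (d : 'I_l -> nat) : (forall i, der_homog (d i) (b i)) ->
  (\sum_i d i)%N = #|` A|.
Proof.
move=> hd; have [u [uE u1]] := saito_det.
have hdet : \det M \is (\sum_i d i)%N.-homog.
  by apply: dhomog_det => i j; rewrite mxE; exact: hd.
have u0 : u != 0 by apply/eqP => u0; case: u1 => w /eqP; rewrite u0 mulr0 oner_eq0.
rewrite uE in hdet.
have [hu /(_ u0) le] := dhomog_divr (Q_neq0 hA halpha) (Q_homog halpha) hdet.
have [w wE] := u1; have hw : w * u \is 0.-homog by rewrite -wE dhomog1.
have [_ le'] := dhomog_divr u0 hu hw.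
apply/eqP; rewrite eqn_leq le andbT -subn_eq0 -leqn0; apply: le'.
by apply/eqP => w0; move/eqP: wE; rewrite w0 mul0r oner_eq0.
Qed.

End Saito.

(** * The derivation of the deletion of a free arrangement *)

Section FreeDeletion.

Variables (K : fieldType) (l : nat).
Local Notation V := 'rV[K]_l.
Local Notation S := {mpoly K[l]}.
Variables (alpha : {vspace V} -> S) (A : {fset {vspace V}}).
Hypothesis hA : arrangement A.
Hypothesis halpha : defining_forms alpha A.
Variables (b : 'I_l -> 'rV[S]_l) (d : 'I_l -> nat).
Hypothesis hb : is_D_basis alpha A b.
Hypothesis hd : forall i, der_homog (d i) (b i).
Implicit Types (L : {vspace V}) (theta : 'rV[S]_l).

(** The coordinates of theta are homogeneous, that of b_i having degree
    e - d_i.  If e < m, they all vanish except the one of index i0. *)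
Lemma basis_degree_le i0 m e theta :
  (forall i, i != i0 -> (m <= d i)%N) -> in_D alpha A theta ->
  der_homog e theta -> (forall f, theta <> f *: b i0) -> (m <= e)%N.
Proof.
move=> dm thD hth thb; have [_ bS bI] := hb; have [c cE] := bS _ thD.
(* The component of degree e of the expansion of theta is again an expansion
   of theta, hence the same one. *)
pose c' i := if (d i <= e)%N then pihomog mdeg (e - d i) (c i) else 0.
have c'E : theta = \sum_i c' i *: b i.
  apply/rowP => j; rewrite -[LHS](pihomog_dE (hth j)) cE !summxE raddf_sum /=.
  apply: eq_bigr => i _; rewrite !mxE (pihomogMr _ _ (hd i j)) /c'.
  by case: ifP => _; rewrite ?mul0r.
have cc' i : c i = c' i.
  apply/eqP; rewrite -subr_eq0; apply/eqP; move: i; apply: bI.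
  by under eq_bigr do rewrite scalerBl; rewrite sumrB -cE -c'E subrr.
rewrite leqNgt; apply/negP => lt_em; apply: (thb (c i0)).
rewrite cE (bigD1 i0) //= big1 ?addr0 // => i /dm le.
by rewrite cc' /c' leqNgt (leq_trans lt_em le) scale0r.
Qed.

Variable H : {vspace V}.
Hypothesis HA : H \in A.
Local Notation A' := (A `\ H).
Variable R : {fset {vspace V}}.
Hypothesis RA : R `<=` A'.
Hypothesis Rinj : {in R &, injective (fun L => (H :&: L)%VS)}.

(** The element phi described at the top.  Its degree is that of a cofactor,
    minus |R| for the division by q, plus that of the matching b_i, minus one
    for the division by alpha H; the degrees of all the b_i add up to |A|. *)
Lemma deletion_derivation : exists phi,
  [/\ in_D alpha A' phi, ~ in_D alpha A phi
    & der_homog (#|` A'| - #|` R|) phi].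
Proof.
have A0 : A != fset0 by apply: contraTneq HA => ->; rewrite inE.
have aH := alpha_homog halpha HA; have a0 := alpha_neq0 hA halpha HA.
have aP := alpha_prime hA halpha HA; set a := alpha H in aH a0 aP *.
have [k ak] := linform_neq0 aH a0.
have RA' L : L \in R -> L \in A' by move/(fsubsetP RA).
have A'A L : L \in A' -> L \in A by rewrite inE => /andP[].
pose q := \prod_(L <- R) restr k a (alpha L).
have q0 : q != 0.
  rewrite /q big_seq; elim/big_rec: _ => [|L p /RA' LA p0]; first exact: oner_neq0.
  by rewrite mulf_neq0 // (rho_neq0 hA halpha).
have hq : q \is #|` R|.-homog.
  rewrite /q card_fset_sum1 big_seq [X in X.-homog]big_seq.
  by apply: dhomog_bigprod => L /RA'; exact: (rho_homog halpha).
have aq : ~ divides a q.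
  rewrite /q big_seq; apply: prime_prod aP _ => L /RA' LA' [g gE].
  have [h hE] := restr_mod k a (alpha L).
  apply: (alpha_ndivides hA halpha HA (A'A _ LA')).
    by move: LA'; rewrite !inE eq_sym => /andP[].
  by exists (h + g); rewrite mulrDl -hE -gE subrK.
have [u [uE u1]] := saito_det hA halpha hb A0.
set M := coef_mx b in uE.
pose m i := cofactor M i k.
have mM j : \sum_i m i * b i 0 j = (\det M) *+ (k == j).
  have /matrixP/(_ k j) := mul_adj_mx M; rewrite !mxE => <-.
  by apply: eq_bigr => i _; rewrite !mxE.
have hm i : m i \is (\sum_(i' | i' != i) d i')%N.-homog.
  by apply: cofactor_homog => i' j; rewrite mxE; exact: hd.
have [bD _ _] := hb.
(* For L in R, the restricted form of L does not involve x_k, so the cofactor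
   only sees its values on the derivations restricted to H. *)
have qm i : divides q (restr k a (m i)).
  apply: divides_prod => [|L L' LR LR' LL'|L LR]; first exact: fset_uniq.
    apply: (rho_coprime hA halpha HA ak); rewrite ?RA' //.
    by apply: contra_neq LL' => /Rinj->.
  have LA' := RA' L LR.
  have hL : restr k a (alpha L) \is 1.-homog by exact: (rho_homog halpha).
  have [j0 cj0] := linform_neq0 hL (rho_neq0 hA halpha HA ak LA').
  have -> : restr k a (m i) = cofactor (map_mx (restr k a) M) i k.
    by rewrite cofactor_map_mx.
  apply: (cofactor_divides (c := fun j => (restr k a (alpha L))@_U_(j)) _ cj0) => [|i' _].
    by rewrite restr_coeff // (alpha_homog halpha) // A'A.
  have [g gE] := bD i' L (A'A _ LA'); have [h hE] := bD i' H HA.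
  exists (restr k a g).
  transitivity (restr k a (der_app (b i') (restr k a (alpha L)))).
    rewrite der_app_linform //. rewrite rmorph_sum; apply: eq_bigr => j _ /=.
    by rewrite restrZ !mxE.
  rewrite {1}(@restr_linform _ _ k a (alpha L)) ?(alpha_homog halpha) ?A'A //.
  rewrite der_appB der_appZ gE hE.
  rewrite rmorphB /= restrZ !rmorphM /= /= restr_self // mulr0 scaler0 subr0.
  by [].
have [n nE] := fin_all_exists qm.
have dM : divides a (\det M).
  by rewrite uE (Q_fsetD1 alpha HA); apply/dividesMl/dividesMr/dividesxx.
(* Modulo a, q n_i is m_i. *)
have rho_m (f : 'I_l -> S) : divides a (\sum_i m i * f i) ->
    divides a (q * \sum_i n i * f i).
  move=> amf; have -> : q * \sum_i n i * f i =
      \sum_i m i * f i - \sum_i (m i - restr k a (m i)) * f i.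
    rewrite -sumrB mulr_sumr; apply: eq_bigr => i _.
    by rewrite nE; ring.
  apply: dividesB => //; apply: divides_sum => i _.
  exact/dividesMr/restr_mod.
have cop := prime_coprime_to aP aq.
have adiv j : divides a (\sum_i n i * b i 0 j).
  apply: cop; apply: (rho_m (fun i => b i 0 j)).
  by rewrite mM -mulr_natl; exact: dividesMl.
have [f fE] := fin_all_exists adiv.
pose phi : 'rV[S]_l := \row_j f j.
have phiE : a *: phi = \sum_i n i *: b i.
  apply/rowP => j; rewrite !mxE summxE mulrC -fE.
  by apply: eq_bigr => i _; rewrite mxE.
have phi_app g : a * der_app phi g = \sum_i n i * der_app (b i) g.
  by rewrite -der_app_scale phiE der_app_sum.
have phiD : in_D alpha A' phi.
  move=> L LA'; have LH : L != H by move: LA'; rewrite !inE => /andP[].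
  apply: (alpha_coprime hA halpha (A'A _ LA') HA LH).
  rewrite -/a phi_app; apply: divides_sum => i _; apply: dividesMl.
  exact: bD (A'A _ LA').
exists phi; split=> //.
- move/(in_D_deletionP HA phiD); rewrite -/a => aphi.
  have [g gE] := fin_all_exists (fun i => bD i H HA); rewrite -/a in gE.
  have phia : der_app phi a = \sum_i n i * g i.
    apply: (mulfI a0); rewrite phi_app mulr_sumr; apply: eq_bigr => i _.
    by rewrite gE; ring.
(* Replacing the column k of M by the b_i(a) = g_i a multiplies the
   determinant by the coefficient of x_k in a. *)
  have mg : \sum_i m i * g i = a@_U_(k) *: (u * Q alpha A').
    apply: (mulfI a0); rewrite -scalerAr mulrCA -(Q_fsetD1 alpha HA) -uE.
    transitivity (\sum_i m i * der_app (b i) a).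
      by rewrite mulr_sumr; apply: eq_bigr => i _; rewrite gE; ring.
    under eq_bigr do rewrite der_app_linform // mulr_sumr.
    rewrite exchange_big /= (bigD1 k) //= [X in _ + X]big1 ?addr0 => [|j jk].
      under eq_bigr do rewrite -scalerAr.
      by rewrite -scaler_sumr mM eqxx.
    under eq_bigr do rewrite -scalerAr.
    by rewrite -scaler_sumr mM eq_sym (negPf jk) mulr0n scaler0.
  have : divides a (\sum_i m i * g i).
    have -> : \sum_i m i * g i = q * der_app phi a + \sum_i (m i - restr k a (m i)) * g i.
      rewrite phia mulr_sumr -big_split /=; apply: eq_bigr => i _.
      by rewrite nE; ring.
    apply: dividesD; first exact: dividesMl.
    by apply: divides_sum => i _; exact/dividesMr/restr_mod.
  rewrite mg => /(divides_scale ak); have [_ a1 aM] := aP; case/aM => [au|].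
    by apply: a1; exact: divides_trans u1.
  rewrite /Q big_seq; apply: prime_prod aP _ => L LA'.
  apply: (alpha_ndivides hA halpha HA (A'A _ LA')).
  by move: LA'; rewrite !inE eq_sym => /andP[].
- move=> j; rewrite mxE.
  have -> : (#|` A'| - #|` R| = (#|` A| - #|` R|) - 1)%N.
    by rewrite (cardfsD1 H A) HA; lia.
  have [|//] := dhomog_divr a0 aH (p := f j) (d := (#|` A| - #|` R|)%N).
  rewrite -fE; apply: rpred_sum => i _.
  have hn : n i * q \is (\sum_(i' | i' != i) d i')%N.-homog.
    by rewrite -nE; exact: restr_homog.
  have [hni le] := dhomog_divr q0 hq hn.
  have [->|/le {}le] := eqVneq (n i) 0; first by rewrite mul0r dhomog0.
  have := dhomogM hni (hd i j).
  suff -> : (\sum_(i' | i' != i) d i' - #|` R| + d i = #|` A| - #|` R|)%N by [].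
  have <- := sum_exponents hA halpha hb A0 hd.
  by rewrite [in RHS](bigD1 i) //= [in RHS]addnC addnBAC.
Qed.

End FreeDeletion.

(** * The theorem *)

Lemma essential_neq0 (K : fieldType) (l : nat) (A : {fset {vspace 'rV[K]_l}}) :
  (0 < l)%N -> essential A -> A != fset0.
Proof.
move=> l0 hess; apply/eqP => A0; move: hess; rewrite /essential A0 big_seq_fset0.
move/(congr1 (fun U => \dim U)); rewrite dimvf dimv0 /dim /= mul1n => l_0.
by rewrite l_0 in l0.
Qed.

Theorem theorem2p17 (K : fieldType) (hK : [pchar K] =i pred0)
  (l : nat) (hl : (2 <= l)%N)
  (A : {fset {vspace 'rV[K]_l}}) (hA : arrangement A)
  (alpha : {vspace 'rV[K]_l} -> {mpoly K[l]}) (halpha : defining_forms alpha A)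
  (d2 : nat) (ds : seq nat)
  (hd : sorted leq [:: 1%N, d2 & ds])
  (hfree : free_with_exponents alpha A [:: 1%N, d2 & ds])
  (H : {vspace 'rV[K]_l}) (hH : H \in A)
  (hess : essential A) (hess' : essential (A `\ H)) :
  (r_is alpha (A `\ H) (d2 - 1)%N
     <-> (#|` A| - #|` restriction A H|)%N = d2) /\
  ((#|` A| - #|` restriction A H|)%N <> d2 -> r_is alpha (A `\ H) d2).
Proof.
have [szd [b [hb b0 bd]]] := hfree.
set dd := [:: 1%N, d2 & ds] in hd szd bd.
have l0 : (0 < l)%N by exact: ltnW.
pose i0 := Ordinal l0; pose i1 := Ordinal hl.
have bi0 : b i0 = euler K l by exact: b0.
have d2_gt0 : (0 < d2)%N by case/andP: hd.
have dmin i : i != i0 -> (d2 <= nth 0%N dd i)%N.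
  move=> ii0; have i_gt0 : (0 < i)%N.
    by rewrite lt0n; apply: contra_neq ii0 => i_0; apply: val_inj.
  by apply: (sorted_leq_nth leq_trans leqnn 0%N hd 1 i); rewrite ?inE ?szd.
have A'0 : A `\ H != fset0 by exact: essential_neq0 hess'.
have hA' : arrangement (A `\ H) by move=> L; rewrite inE => /andP[_ /hA].
have halpha' : defining_forms alpha (A `\ H).
  by move=> L; rewrite inE => /andP[_ /halpha].
have D0P := D0_deg_nonzeroP hA' halpha' hK A'0.
have lowA e theta : in_D alpha A theta -> der_homog e theta ->
    (forall f, theta <> f *: euler K l) -> (d2 <= e)%N.
  by rewrite -bi0; exact: (basis_degree_le hb bd dmin).
(* Multiplication by the form of H maps D_0(A') into D(A) and raises the degree
   by one. *)
have lower e : D0_deg_nonzero alpha (A `\ H) e -> (d2 <= e.+1)%N.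
  case=> theta [th0 hth th]; apply: (lowA _ (alpha H *: theta)).
  - exact: (in_D_deletion_mul (D0_in_D hA' halpha' th0)).
  - move=> i; rewrite mxE; apply: (@dhomogM _ _ _ 1%N _ e); last exact: hth.
    exact: (alpha_homog halpha).
  - move=> f fE; have f0 : f = 0.
      apply: (in_D0_euler hA' halpha' hK A'0).
      by rewrite /in_D0 -fE der_app_scale th0 mulr0.
    move/eqP: fE; rewrite f0 scale0r scalemx_eq0 (negPf th).
    by rewrite (negPf (alpha_neq0 hA halpha hH)).
(* The basis element of degree d_2 is not a multiple of the Euler derivation. *)
have upper : D0_deg_nonzero alpha (A `\ H) d2.
  apply/D0P; exists (b i1); have [bD _ bI] := hb; split.
  - exact/in_D_deletion/bD.
  - exact: bd i1.
  - move=> f; rewrite -bi0 => bE.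
    pose c i := (i == i1)%:R - f * (i == i0)%:R : {mpoly K[l]}.
    have sumb j : \sum_i (i == j)%:R *: b i = b j.
      rewrite (bigD1 j) //= eqxx scale1r big1 ?addr0 // => i /negPf ->.
      by rewrite scale0r.
    have : \sum_i c i *: b i = 0.
      under eq_bigr do rewrite /c scalerBl -scalerA.
      by rewrite sumrB -scaler_sumr !sumb bE subrr.
    move/bI/(_ i1)/eqP; rewrite /c eqxx mulr0 subr0.
    by rewrite oner_eq0.
have [R [RA cR Rinj Rsurj]] := fset_transversal (fun L => (H :&: L)%VS) (A `\ H).
have cR' : #|` restriction A H| = #|` R| by rewrite cR.
have RA' : (#|` R| <= #|` A `\ H|)%N by exact: fsubset_leq_card.
have cA : #|` A| = (#|` A `\ H|).+1 by rewrite (cardfsD1 H) hH.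
have iffD : D0_deg_nonzero alpha (A `\ H) (d2 - 1) <->
    (#|` A| - #|` restriction A H|)%N = d2.
  have [phi [phiD phiA hphi]] := deletion_derivation hA halpha hb bd hH RA Rinj.
  have phi0 : D0_deg_nonzero alpha (A `\ H) (#|` A `\ H| - #|` R|).
    apply/D0P; exists phi; split=> // f phiE; apply: phiA => L LA.
    by rewrite phiE der_app_scale der_app_euler ?(alpha_homog halpha) //; exists f.
  split=> [/D0P[theta [thD hth thE]]|e]; last first.
    by rewrite -e cR' cA; move: phi0; congr (D0_deg_nonzero _ _ _); lia.
  have thA : ~ in_D alpha A theta.
    by move=> thA; have := lowA _ _ thA hth thE; lia.
  have [k ak] := linform_neq0 (alpha_homog halpha hH) (alpha_neq0 hA halpha hH).
  have := deletion_degree_ge hA halpha hH ak RA Rsurj thD hth thA.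
  move: RA' d2_gt0 (lower _ phi0); rewrite cR' cA.
  by move: #|` R| #|` A `\ H| => r n; lia.
split; first split.
- by case=> /iffD.
- move/iffD => ?; split=> // e /lower; lia.
- move=> ne; split=> // e he; have := lower e he; rewrite leq_eqVlt => /orP[/eqP de|//].
  case: ne; apply/iffD; rewrite de subn1; exact: he.
Qed.
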